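(* Let $M$ be either $B_n^+$ or $B_n^{+*}$ ($n\ge2$), with generating set $\Sigma$. For $x\in M$ let $M[x]=\{y\in M:\tau(x\cdot y)=\tau(x)\}$. Let $f,h:M\to\mathbb R$ be any two functions. Then $h(x)=\sum_{X\subseteq\Sigma:\ \Delta_X\in M[x]}(-1)^{|X|}f(x\cdot\Delta_X)$ for all $x\in M$ (i.e. $h$ is the graded Möbius transform of $f$) if and only if $f(x)=\sum_{y\in M[x]}h(x\cdot y)$ for all $x\in M$.
   Context: $M$ is either (a) the positive braid monoid $B_n^+$, generated by $\Sigma=\{\sigma_1,\dots,\sigma_{n-1}\}$ with relations $\sigma_i\sigma_j=\sigma_j\sigma_i$ for $|i-j|\ge2$, $\sigma_i\sigma_j\sigma_i=\sigma_j\sigma_i\sigma_j$ for $|i-j|=1$; or (b) the dual braid monoid $B_n^{+*}$, generated by $\Sigma=\{\sigma_{i,j}:1\le i<j\le n\}$ ($\sigma_{j,i}=\sigma_{i,j}$) with relations $\sigma_{i,j}\sigma_{j,k}=\sigma_{j,k}\sigma_{k,i}=\sigma_{k,i}\sigma_{i,j}$ for $i<j<k$ and $\sigma_{i,j}\sigma_{k,\ell}=\sigma_{k,\ell}\sigma_{i,j}$ whenever $i<j<k<\ell$ or $i<k<\ell<j$. Unit $\mathbf e$; $x\le_l y$ iff $y=xz$. $M$ is a Garside monoid; for $X\subseteq\Sigma$, $\Delta_X$ is the least upper bound of $X$ for $\le_l$ (also for right divisibility), $\Delta=\Delta_\Sigma$, and the simple braids $\mathcal S_n$ are the left divisors of $\Delta$.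 For $x\in\mathcal S_n$ let $\mathsf R(x)=\{\sigma\in\Sigma:x\sigma\notin\mathcal S_n\}$, $\mathsf L(x)=\{\sigma\in\Sigma:\sigma\le_l x\}$, and $x\to y$ iff $\mathsf L(y)\subseteq\mathsf R(x)$. Every $x\ne\mathbf e$ is uniquely $x=x_1\cdots x_k$ with $x_i\in\mathcal S_n\setminus\{\mathbf e\}$ and $x_i\to x_{i+1}$ (Garside normal form); its height is $\tau(x)=k$. By convention $\tau(\mathbf e)=1$. *)

(* Defs.v *)
From HB Require Import structures.
From mathcomp Require Import all_boot all_order all_algebra generic_quotient.
From mathcomp Require Import boolp classical_sets fsbigop reals.
Set Implicit Arguments. Unset Strict Implicit. Unset Printing Implicit Defensive.
Import Order.TTheory GRing.Theory Num.Theory.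
Local Open Scope quotient_scope.

Section Presented.
Variables (A : finType) (r : seq A -> seq A -> Prop).

Inductive cong : seq A -> seq A -> Prop :=
| cong_refl u : cong u u
| cong_step p u v q : r u v -> cong (p ++ u ++ q) (p ++ v ++ q)
| cong_sym u v : cong u v -> cong v u
| cong_trans u v w : cong u v -> cong v w -> cong u w.

Definition eqw (u v : seq A) : bool := `[< cong u v >].

Lemma eqw_refl : reflexive eqw.
Proof. by move=> u; apply/asboolP; apply: cong_refl. Qed.
Lemma eqw_sym : symmetric eqw.
Proof.
by move=> u v; apply/asboolP/asboolP; apply: cong_sym.
Qed.
Lemma eqw_trans : transitive eqw.
Proof.
move=> v u w /asboolP Huv /asboolP Hvw; apply/asboolP.
exact: cong_trans Huv Hvw.
Qed.

Definition eqw_equiv : equiv_rel (seq A) := EquivRel eqw eqw_refl eqw_sym eqw_trans.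

Definition Mon := {eq_quot eqw_equiv}%qT.

Definition bone : Mon := \pi_Mon [::].
Definition bmul (x y : Mon) : Mon := \pi_Mon (repr x ++ repr y).
Definition gen (s : A) : Mon := \pi_Mon [:: s].

Definition leL (x y : Mon) : Prop := exists z, y = bmul x z.

Definition is_lcm (X : {set A}) (d : Mon) : Prop :=
  (forall s, s \in X -> leL (gen s) d) /\
  (forall e, (forall s, s \in X -> leL (gen s) e) -> leL d e).

(* Delta_X : the least upper bound of X (exists since M is Garside) *)
Definition DeltaX (X : {set A}) : Mon := xget bone (is_lcm X).
Definition Delta : Mon := DeltaX [set: A]%SET.

Definition simple (x : Mon) : Prop := leL x Delta.

(* x -> y  iff  L(y) is contained in R(x) *)
Definition arrow (x y : Mon) : Prop :=
  forall s : A, leL (gen s) y -> ~ simple (bmul x (gen s)).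

Definition prod_seq (s : seq Mon) : Mon := foldr bmul bone s.

Definition is_nf (x : Mon) (s : seq Mon) : Prop :=
  [/\ s <> [::], x = prod_seq s,
      (forall a, a \in s -> simple a /\ a <> bone) &
      (forall i, i.+1 < size s -> arrow (nth bone s i) (nth bone s i.+1))].

(* height tau; tau(e) = 1 by convention *)
Definition tau (x : Mon) : nat :=
  if x == bone then 1 else size (xget [::] (is_nf x)).

Definition Mset (x : Mon) : set Mon := [set y | tau (bmul x y) = tau x].

End Presented.

Inductive kind := Artin | DualBraid.

(* Artin generator i : 'I_n.-1 stands for sigma_(i+1) *)
Inductive artin_rel (n : nat) : seq 'I_n.-1 -> seq 'I_n.-1 -> Prop :=
| ar_comm (i j : 'I_n.-1) : (i.+1 < j)%N \/ (j.+1 < i)%N ->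
    artin_rel [:: i; j] [:: j; i]
| ar_braid (i j : 'I_n.-1) : (i.+1 = j :> nat) \/ (j.+1 = i :> nat) ->
    artin_rel [:: i; j; i] [:: j; i; j].

(* dual generator p = (i, j) with i < j (0-based) stands for sigma_(i+1,j+1) *)
Definition dgen (n : nat) := {p : 'I_n * 'I_n | (p.1 < p.2)%N}.
Definition ends n (a : dgen n) : nat * nat := (nat_of_ord (val a).1, nat_of_ord (val a).2).

Inductive dual_rel (n : nat) : seq (dgen n) -> seq (dgen n) -> Prop :=
| dr_tri1 (a b c : dgen n) (i j k : nat) : (i < j < k)%N ->
    ends a = (i, j) -> ends b = (j, k) -> ends c = (i, k) ->
    dual_rel [:: a; b] [:: b; c]
| dr_tri2 (a b c : dgen n) (i j k : nat) : (i < j < k)%N ->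
    ends a = (i, j) -> ends b = (j, k) -> ends c = (i, k) ->
    dual_rel [:: b; c] [:: c; a]
| dr_comm (a b : dgen n) (i j k l : nat) :
    ((i < j)%N && (j < k < l)%N) || ((i < k)%N && (k < l < j)%N) ->
    ends a = (i, j) -> ends b = (k, l) ->
    dual_rel [:: a; b] [:: b; a].

Definition gens (k : kind) (n : nat) : finType :=
  match k with
  | Artin => 'I_n.-1
  | DualBraid => {p : 'I_n * 'I_n | (p.1 < p.2)%N}
  end.

Definition brel (k : kind) (n : nat) : seq (gens k n) -> seq (gens k n) -> Prop :=
  match k as k0 return seq (gens k0 n) -> seq (gens k0 n) -> Prop with
  | Artin => @artin_rel n
  | DualBraid => @dual_rel n
  end.

Definition BM (k : kind) (n : nat) := Mon (@brel k n).

(* Main.v *)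
Require Import Defs.
From HB Require Import structures.
From mathcomp Require Import all_boot all_order all_algebra zify generic_quotient.
From mathcomp Require Import boolp classical_sets functions cardinality fsbigop reals.
Set Implicit Arguments. Unset Strict Implicit. Unset Printing Implicit Defensive.
Import GRing.Theory Num.Theory.

(* Both presentations are complemented: any two generators s, t have a common
   multiple s (C s t) = t (C t s). Once the cube condition is checked on triples
   of generators, Garside's induction on word length shows that this common
   multiple is the lcm and that the monoid is left cancellative. Moreover
   s Delta = Delta (phi s) for a permutation phi of the generators, so that the
   left divisors of Delta^j are exactly the products of j simple elements and
   tau x is the least positive j with x <= Delta^j. Hence tau is monotone and
   M[x] is finite and closed under left divisors. Writing S for the Moebius
   transform and T for the summation operator, S (T h) (x) is the sum over z in
   M[x] of h (x z) times the sum of (-1)^|X| over the sets X of generators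
   dividing z on the left, which vanishes unless z = e; thus S T = id. As S is
   unitriangular with respect to length on the elements of a given height, it is
   injective, and T S = id follows. *)

(** * The monoid presented by words *)

Section Words.
Variables (A : finType) (r : seq A -> seq A -> Prop).
Local Notation "u ~ v" := (cong r u v) (at level 70).
Local Notation M := (Mon r).
Local Notation one := (bone r).
Local Notation "x ** y" := (bmul x y) (at level 40, left associativity).

Lemma cong_rel u v : r u v -> u ~ v.
Proof. by move=> /(@cong_step _ _ [::] _ _ [::]); rewrite !cats0. Qed.

Lemma cong_ctx p u v q : u ~ v -> p ++ u ++ q ~ p ++ v ++ q.
Proof.
elim=> {u v} [u|p' u v q' h|u v _ h|u v w _ h1 _ h2].
- exact: cong_refl.
- by have := cong_step (p ++ p') (q' ++ q) h; rewrite -!catA.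
- exact: cong_sym.
- exact: cong_trans h1 h2.
Qed.

Lemma cong_catl p u v : u ~ v -> p ++ u ~ p ++ v.
Proof. by move=> /(cong_ctx p [::]); rewrite !cats0. Qed.

Lemma cong_catr q u v : u ~ v -> u ++ q ~ v ++ q.
Proof. exact: (@cong_ctx [::]). Qed.

Definition word (u : seq A) : M := (\pi_M u)%qT.

Lemma wordP u v : word u = word v <-> u ~ v.
Proof.
split=> [e|uv]; last by apply/eqquotP/asboolP.
by apply/asboolP; move/eqquotP: e.
Qed.

Lemma word_repr (x : M) : word (repr x) = x.
Proof. exact: reprK. Qed.

Lemma word_surj (x : M) : exists u, x = word u.
Proof. by exists (repr x); rewrite word_repr. Qed.

Lemma word_cat u v : word (u ++ v) = word u ** word v.
Proof.
apply/wordP; apply: (@cong_trans _ _ _ (repr (word u) ++ v)).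
  by apply/cong_catr/wordP; rewrite word_repr.
by apply/cong_catl/wordP; rewrite word_repr.
Qed.

Lemma word_cons s u : word (s :: u) = gen r s ** word u.
Proof. exact: (word_cat [:: s]). Qed.

Lemma bmulA (x y z : M) : x ** (y ** z) = x ** y ** z.
Proof.
have [u ->] := word_surj x; have [v ->] := word_surj y.
by have [w ->] := word_surj z; rewrite -!word_cat catA.
Qed.

Lemma bmul1m (x : M) : one ** x = x.
Proof. by have [u ->] := word_surj x; rewrite -(word_cat [::]). Qed.

Lemma bmulm1 (x : M) : x ** one = x.
Proof. by have [u ->] := word_surj x; rewrite -(word_cat _ [::]) cats0. Qed.

Lemma leL_refl (x : M) : leL x x.
Proof. by exists one; rewrite bmulm1. Qed.

Lemma leL_trans (x y z : M) : leL x y -> leL y z -> leL x z.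
Proof. by move=> [a ->] [b ->]; exists (a ** b); rewrite bmulA. Qed.

Lemma leL_mulr (x y : M) : leL x (x ** y).
Proof. by exists y. Qed.

End Words.

(** * Word reversing *)

Section Reversing.
Variables (T : Type) (C : T -> T -> seq T).

(* When every s (C s t) equals t (C t s), an output (p, q) satisfies u p = v q. *)
Fixpoint rev_words (fuel : nat) (u v : seq T) : option (seq T * seq T) :=
  match fuel, u, v with
  | _, [::], _ => Some (v, [::])
  | _, _, [::] => Some ([::], u)
  | 0, _, _ => None
  | k.+1, s :: u', t :: v' =>
    if rev_words k u' (C s t) is Some (p1, q1) then
      if rev_words k v' (C t s) is Some (p2, q2) then
        if rev_words k q1 q2 is Some (p3, q3) then Some (p1 ++ p3, p2 ++ q3)
        else None
      else None
    else None
  end.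

(* If (p, q) completes C m s and C m t to their lcm, then m (C m s) p is a
   multiple of s (C s t), compatibly with its expressions through s and t. *)
Definition cube (k : nat) (s m t : T) : bool :=
  if rev_words k (C m s) (C m t) is Some (p, q) then
    if rev_words k (C s m ++ p) (C s t) is Some ([::], d) then
      if rev_words k (C t m ++ q) (C t s ++ d) is Some ([::], [::]) then true
      else false
    else false
  else false.

End Reversing.

Section ReversingMap.
Variables (T T' : Type) (C : T -> T -> seq T) (C' : T' -> T' -> seq T').
Variables (f : T -> T') (P : pred T).
Hypothesis CP : forall s t, P s -> P t -> all P (C s t).
Hypothesis fC : forall s t, P s -> P t -> C' (f s) (f t) = map f (C s t).

(** Reversing only ever produces letters taken from values of [C], so it commutes with a letter map
    that respects the complements. Since this respect is known on [P] only, the induction also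
    carries the stability of [P]. This transfers cube conditions from letters on which they can be
    computed. *)
Lemma rev_words_map k u v : all P u -> all P v ->
  (forall p q, rev_words C k u v = Some (p, q) -> all P p && all P q) /\
  rev_words C' k (map f u) (map f v) =
    omap (fun pq => (map f pq.1, map f pq.2)) (rev_words C k u v).
Proof.
elim: k u v => [|k IH] [|s u] [|t v] //=; try by
  move=> Pu Pv; split=> // p q [<- <-]; rewrite /= ?Pu ?Pv.
move=> /andP[Ps Pu] /andP[Pt Pv]; rewrite !fC //.
have [P1 ->] := IH u _ Pu (CP Ps Pt).
case: rev_words P1 => [[p1 q1]|] //= /(_ _ _ erefl) /andP[Pp1 Pq1].
have [P2 ->] := IH v _ Pv (CP Pt Ps).
case: rev_words P2 => [[p2 q2]|] //= /(_ _ _ erefl) /andP[Pp2 Pq2].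
have [P3 ->] := IH _ _ Pq1 Pq2.
case: rev_words P3 => [[p3 q3]|] //= /(_ _ _ erefl) /andP[Pp3 Pq3].
by rewrite !map_cat; split=> // p q [<- <-]; rewrite !all_cat Pp1 Pp2 Pp3.
Qed.

Lemma cube_map k s m t : P s -> P m -> P t ->
  cube C k s m t -> cube C' k (f s) (f m) (f t).
Proof.
move=> Ps Pm Pt; rewrite /cube !fC //.
have [P1 ->] := rev_words_map k (CP Pm Ps) (CP Pm Pt).
case: rev_words P1 => [[p q]|] //= /(_ _ _ erefl) /andP[Pp Pq].
have Pp' : all P (C s m ++ p) by rewrite all_cat CP.
have [P2] := rev_words_map k Pp' (CP Ps Pt); rewrite map_cat => ->.
case: rev_words P2 => [[[|//] d]|] //= /(_ _ _ erefl) Pd.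
have Pq' : all P (C t m ++ q) by rewrite all_cat CP.
have Pd' : all P (C t s ++ d) by rewrite all_cat CP.
have [_] := rev_words_map k Pq' Pd'; rewrite !map_cat => ->.
by case: rev_words => [[[|//] [|//]]|].
Qed.

End ReversingMap.

(** * Lcms and cancellation from the cube condition *)

Definition homogeneous (A : finType) (r : seq A -> seq A -> Prop) :=
  forall u v, r u v -> size u = size v.

(** The third clause makes every defining relation one of the chosen lcm relations, which is what an
    induction on derivations requires. In the last clause [k] is only the fuel of the reversing
    procedure. *)
Definition complement_for (A : finType) (r : seq A -> seq A -> Prop)
    (C : A -> A -> seq A) :=
  [/\ forall s, C s s = [::],
      forall s t, word r (s :: C s t) = word r (t :: C t s),
      forall u v, r u v -> exists s t, u = s :: C s t /\ v = t :: C t s &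
      forall s m t, s != m -> m != t -> s != t -> exists k, cube C k s m t].

Section Length.
Variables (A : finType) (r : seq A -> seq A -> Prop).
Hypothesis r_hom : homogeneous r.
Local Notation M := (Mon r).
Local Notation one := (bone r).
Local Notation "x ** y" := (bmul x y) (at level 40, left associativity).

Definition len (x : M) : nat := size (repr x).

Lemma cong_size u v : cong r u v -> size u = size v.
Proof.
elim=> {u v} // [p u v q /r_hom e|u v w _ -> _ //].
by rewrite !size_cat e.
Qed.

Lemma len_word u : len (word r u) = size u.
Proof. by apply: cong_size; apply/wordP; rewrite word_repr. Qed.

Lemma len_mul (x y : M) : len (x ** y) = len x + len y.
Proof.
have [u ->] := word_surj x; have [v ->] := word_surj y.
by rewrite -word_cat !len_word size_cat.
Qed.

Lemma len_gen s : len (gen r s) = 1.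
Proof. exact: (len_word [:: s]). Qed.

Lemma len_eq0 (x : M) : len x = 0 -> x = one.
Proof. by have [[|s u] ->] := word_surj x; rewrite len_word. Qed.

Lemma len_one : len one = 0.
Proof. exact: (len_word [::]). Qed.

Lemma leL_len (x y : M) : leL x y -> len x <= len y.
Proof. by move=> [z ->]; rewrite len_mul leq_addr. Qed.

Lemma leL_anti (x y : M) : leL x y -> leL y x -> x = y.
Proof.
move=> [z ->] /leL_len; rewrite len_mul => h.
by rewrite (@len_eq0 z) ?bmulm1 //; lia.
Qed.

Lemma leL_one (x : M) : leL x one -> x = one.
Proof. by move=> h; apply: leL_anti => //; exists x; rewrite bmul1m. Qed.

Lemma not_one_gen (x : M) : x <> one -> exists s y, x = gen r s ** y.
Proof.
have [[|s u] ->] := word_surj x; first by case.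
by exists s, (word r u); rewrite word_cons.
Qed.

Lemma gen_mul_neq1 s (x : M) : gen r s ** x <> one.
Proof. by move=> /(congr1 len); rewrite len_mul len_gen len_one. Qed.

End Length.

Section Complement.
Variables (A : finType) (r : seq A -> seq A -> Prop) (C : A -> A -> seq A).
Hypothesis r_hom : homogeneous r.
Hypothesis rC : complement_for r C.
Local Notation M := (Mon r).
Local Notation one := (bone r).
Local Notation "x ** y" := (bmul x y) (at level 40, left associativity).
Local Notation len := (@len A r).
Local Notation word := (word r).

Let len_word := len_word r_hom.
Let len_mul := len_mul r_hom.
Let len_gen := len_gen r_hom.

Lemma rev_words_sound k u v p q :
  rev_words C k u v = Some (p, q) -> word (u ++ p) = word (v ++ q).
Proof.
have [_ hC _ _] := rC.
elim: k u v p q => [|k IH] [|s u] [|t v] p q //=; try by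
  move=> [<- <-]; rewrite ?cats0.
case E1: rev_words => [[p1 q1]|] //; case E2: rev_words => [[p2 q2]|] //.
case E3: rev_words => [[p3 q3]|] // [<- <-].
rewrite !word_cons !catA (word_cat _ (u ++ p1)) (word_cat _ (v ++ p2)).
rewrite (IH _ _ _ _ E1) (IH _ _ _ _ E2).
rewrite -(word_cat _ (C s t ++ q1)) -(word_cat _ (C t s ++ q2)) -!catA.
rewrite (word_cat _ (C s t)) (word_cat _ (C t s)) (IH _ _ _ _ E3) !bmulA.
by rewrite -!word_cons hC.
Qed.

(** The lcm property of pairs of generators, bounded in length so that it can serve as induction
    hypothesis in Garside's argument. *)
Definition gen_lcm_upto N := forall s t (x y : M), len (gen r s ** x) <= N ->
  gen r s ** x = gen r t ** y ->
  exists w, x = word (C s t) ** w /\ y = word (C t s) ** w.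

(** Converse to [rev_words_sound]: a successful reversing computes an lcm. Each step applies the
    hypothesis to the two first letters, and the three recursive calls concern elements of smaller
    length, so the bound [N] is never exceeded. *)
Lemma rev_words_complete N : gen_lcm_upto N -> forall k u v p q,
  rev_words C k u v = Some (p, q) -> forall x y : M, len (word u ** x) <= N ->
  word u ** x = word v ** y -> exists w, x = word p ** w /\ y = word q ** w.
Proof.
move=> H; elim=> [|k IH] [|s u] [|t v] p q //=; try by
  move=> [<- <-] x y _; rewrite ?(bmul1m (_ : M)) => e;
  [exists y + exists x]; rewrite bmul1m.
case E1: rev_words => [[p1 q1]|] //; case E2: rev_words => [[p2 q2]|] //.
case E3: rev_words => [[p3 q3]|] // [<- <-] x y hN.
rewrite !word_cons -!bmulA => e.
have /= hN' : len (gen r s ** (word u ** x)) <= N.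
  by rewrite bmulA -word_cons.
have eN : len (gen r s ** (word u ** x)) = len (gen r t ** (word v ** y)).
  by rewrite e.
have [w [e1 e2]] := H _ _ _ _ hN' e.
move: (congr1 len e1) (congr1 len e2) hN' eN; rewrite !len_mul !len_gen.
move=> l1 l2 hN' eN.
have [|w1 [e3 e4]] := IH _ _ _ _ E1 _ _ _ e1; first by rewrite len_mul; lia.
have [|w2 [e5 e6]] := IH _ _ _ _ E2 _ _ _ e2; first by rewrite len_mul; lia.
move: (congr1 len e4) (congr1 len e6); rewrite !len_mul => l3 l4.
have [||w3 [e7 e8]] := IH _ _ _ _ E3 w1 w2.
- by rewrite len_mul; lia.
- by rewrite -e4.
by exists w3; rewrite !word_cat -!bmulA -e7 -e8.
Qed.

(* Given s x = m z = t y, the induction hypothesis on the shorter element z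
   yields the lcm of C m s and C m t, and the cube condition turns it into a
   multiple of the lcm of s and t. *)
Lemma gen_lcm_step N : gen_lcm_upto N -> forall s m t (a b : M),
  len (word (C m s) ** a) <= N -> word (C m s) ** a = word (C m t) ** b ->
  exists w, word (C s m) ** a = word (C s t) ** w /\
            word (C t m) ** b = word (C t s) ** w.
Proof.
have [hCC hC _ hcube] := rC; move=> H s m t a b hN e.
have [es|ns] := eqVneq s m.
  by move: e; rewrite {}es hCC !bmul1m => ->; exists b.
have [et|nt] := eqVneq m t.
  by move: e; rewrite -{}et hCC !bmul1m => <-; exists a.
have [est|nst] := eqVneq s t.
  move: est e hN => <- e hN; suff -> : a = b.
    by exists (word (C s m) ** b); rewrite hCC !bmul1m.
  have L (u : seq A) : exists k, rev_words C k u u = Some ([::], [::]).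
    elim: u => [|c u [k Ek]]; first by exists 0.
    by exists k.+1 => /=; rewrite hCC; case: k u Ek => [|k] [|d u] //= ->.
  have [k Ek] := L (C m s).
  have [w [-> ->]] := rev_words_complete H Ek hN e.
  by [].
have [k] := hcube _ _ _ ns nt nst; rewrite /cube.
case E1: rev_words => [[p q]|] //; case E2: rev_words => [[[|//] d]|] //.
case E3: rev_words => [[[|//] [|//]]|] // _.
have [w [-> ->]] := rev_words_complete H E1 hN e.
exists (word d ** w); rewrite !bmulA -!word_cat; split.
  by have := rev_words_sound E2; rewrite cats0 => ->.
by have := rev_words_sound E3; rewrite !cats0 => ->.
Qed.

Lemma gen_lcm_uptoT N : gen_lcm_upto N.
Proof.
have [hCC hC hr _] := rC.
elim: N => [|N IH] s t x y; first by rewrite len_mul len_gen.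
have [u ->] := word_surj x; have [v ->] := word_surj y.
rewrite -!word_cons len_word /= ltnS => su /wordP.
(* Generalising to arbitrary congruent words allows induction on the derivation. A relation applied
   at the head is an lcm relation, one applied further right keeps the first letter, and
   transitivity through a word starting with [m] is handled by [gen_lcm_step]. *)
suff main a b : cong r a b -> forall s t u v, a = s :: u -> b = t :: v ->
    size u <= N ->
    exists w, word u = word (C s t) ** w /\ word v = word (C t s) ** w.
  by move/main; apply.
elim=> {s t x y u v su a b} [a|p u' v' q h|a b h IHab|a c b hac IHac hcb IHcb]
  s t u v.
- by move=> -> [<- <-] _; exists (word u); rewrite hCC bmul1m.
- have [s' [t' [eu ev]]] := hr _ _ h.
  case: p => [|m p] /=.
    rewrite eu ev => -[<- <-] [<- <-] _.
    by exists (word q); rewrite !word_cat.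
  move=> [<- <-] [<- <-] _; exists (word (p ++ u' ++ q)).
  rewrite hCC !bmul1m; split=> //.
  by apply/wordP/cong_sym; exact: cong_step.
- move=> eb ea sN; have /eqP := cong_size r_hom h; rewrite eb ea /= eqSS => /eqP e.
  by have [|w [e1 e2]] := IHab _ _ _ _ ea eb; [rewrite e|exists w].
- move=> ea eb sN; have := cong_size r_hom hac; rewrite ea.
  case: c hac IHac hcb IHcb => [|m z] // hac IHac hcb IHcb [e].
  have [w1 [e1 e2]] := IHac _ _ _ _ ea erefl sN.
  have [|w2 [e3 e4]] := IHcb _ _ _ _ erefl eb; first by rewrite -e.
  rewrite e1 e4; apply: (gen_lcm_step IH); last by rewrite -e2.
  by rewrite -e2 len_word -e.
Qed.

Lemma gen_lcm s t (x y : M) : gen r s ** x = gen r t ** y ->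
  exists w, x = word (C s t) ** w /\ y = word (C t s) ** w.
Proof. exact: (@gen_lcm_uptoT _ s t x y (leqnn _)). Qed.

(** Cancelling one generator is the case s = t of [gen_lcm]: as [C s s] is empty, both cofactors
    equal the same w. *)
Lemma bmul_injl (z x y : M) : z ** x = z ** y -> x = y.
Proof.
have [hCC _ _ _] := rC; have [u ->] := word_surj z.
elim: u => [|s u IH]; first by rewrite !bmul1m.
rewrite word_cons -!bmulA => /gen_lcm [w []].
by rewrite hCC !bmul1m => e1 e2; apply: IH; rewrite e1 e2.
Qed.

Definition lcm_pair (x y p q : M) := x ** p = y ** q /\
  forall a b, x ** a = y ** b -> exists w, a = p ** w /\ b = q ** w.

(** The lcm is assembled from four tiles: the lcm of the first letters s and t, those of x' with
    [C s t] and of y' with [C t s], and that of the two remaining complements. The given common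
    multiple bounds the lengths and makes the induction terminate. *)
Lemma lcm_pair_ex (x y a b : M) : x ** a = y ** b -> exists p q, lcm_pair x y p q.
Proof.
have [hCC hC _ _] := rC.
move En : (len (x ** a)) => n; elim/ltn_ind: n => n IH in x y a b En *.
have [->|/eqP/not_one_gen [s [x' ex]]] := eqVneq x one.
  by exists y, one; split=> [|c d]; rewrite ?bmulm1 bmul1m // => ->; exists d;
     rewrite bmul1m.
have [->|/eqP/not_one_gen [t [y' ey]]] := eqVneq y one.
  by exists one, x; split=> [|c d]; rewrite ?bmulm1 bmul1m // => <-; exists c;
     rewrite bmul1m.
rewrite ex ey in En *; rewrite -!bmulA => e.
have [w [e1 e2]] := gen_lcm e.
have := congr1 len e; move: En; rewrite -bmulA !len_mul !len_gen => En En2.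
have [|p1 [q1 [E1 U1]]] := IH (len (x' ** a)) _ _ _ _ _ erefl e1.
  by rewrite len_mul; lia.
have [|p2 [q2 [E2 U2]]] := IH (len (y' ** b)) _ _ _ _ _ erefl e2.
  by rewrite len_mul; lia.
have [w1 [_ ew1]] := U1 _ _ e1; have [w2 [_ ew2]] := U2 _ _ e2.
have l1 : len (x' ** a) = len (word (C s t)) + len w by rewrite e1 len_mul.
have e3 : q1 ** w1 = q2 ** w2 by rewrite -ew1.
have [|p3 [q3 [E3 U3]]] := IH (len (q1 ** w1)) _ _ _ _ _ erefl e3.
  by move: l1; rewrite len_mul -ew1; lia.
exists (p1 ** p3), (p2 ** q3); split=> [|c d].
  rewrite -!bmulA (bmulA x') E1 (bmulA y') E2 -!bmulA -E3 !bmulA.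
  by rewrite -!word_cons hC.
rewrite -!bmulA => /gen_lcm [v [f1 f2]].
have [v1 [-> g1]] := U1 _ _ f1; have [v2 [-> g2]] := U2 _ _ f2.
have [v3 [-> ->]] := U3 v1 v2 (etrans (esym g1) g2).
by exists v3; rewrite !bmulA.
Qed.

End Complement.

(** * Garside structure and height *)

Definition quasi_central (A : finType) (r : seq A -> seq A -> Prop)
    (D : Mon r) (phi : A -> A) :=
  [/\ is_lcm [set: A] D, injective phi &
      forall s, bmul (gen r s) D = bmul D (gen r (phi s))].

Lemma is_lcm_DeltaX (A : finType) (r : seq A -> seq A -> Prop) (X : {set A})
  (d : Mon r) : homogeneous r -> is_lcm X d -> DeltaX r X = d.
Proof.
move=> r_hom [ub least].
have [ub' least'] : is_lcm X (DeltaX r X).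
  by apply: (@xgetPex _ _ (is_lcm X)); exists d.
by apply: (leL_anti r_hom); [apply: least'|apply: least].
Qed.

Lemma quasi_central_Delta (A : finType) (r : seq A -> seq A -> Prop) (D : Mon r) phi :
  homogeneous r -> quasi_central D phi -> quasi_central (Delta r) phi.
Proof.
by move=> r_hom hD; rewrite /Delta (is_lcm_DeltaX r_hom (d := D)) //; case: hD.
Qed.

Lemma iter_inj_id (T : finType) (f : T -> T) : injective f ->
  exists2 m, 0 < m & forall x, iter m f x = x.
Proof.
(* The product of all orbit lengths is a multiple of each of them. *)
move=> injf; exists (\prod_x fingraph.order f x).
  by rewrite prodn_gt0 // => x; exact: order_gt0.
move=> x; rewrite (bigD1 x) //= mulnC.
elim: (\prod_(_ | _) _) => // k IH.
by rewrite mulSn iterD IH iter_order.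
Qed.

Section Garside.
Variables (A : finType) (r : seq A -> seq A -> Prop).
Variables (C : A -> A -> seq A) (phi : A -> A).
Hypothesis r_hom : homogeneous r.
Hypothesis rC : complement_for r C.
Hypothesis rD : quasi_central (Delta r) phi.
Local Notation M := (Mon r).
Local Notation one := (bone r).
Local Notation "x ** y" := (bmul x y) (at level 40, left associativity).
Local Notation len := (@len A r).
Local Notation word := (word r).
Local Notation D := (Delta r).

Let len_word := len_word r_hom.
Let len_mul := len_mul r_hom.
Let len_gen := len_gen r_hom.
Let cancel_l := bmul_injl r_hom rC.
Implicit Types a b t x y z : M.

Lemma simple_gen s : simple (gen r s).
Proof. by have [[ub _] _ _] := rD; apply: ub; rewrite inE. Qed.

Lemma word_mul_Delta u : word u ** D = D ** word (map phi u).
Proof.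
have [_ _ hD] := rD; elim: u => [|s u IH].
  by rewrite bmul1m bmulm1.
by rewrite /= !word_cons -bmulA IH !bmulA hD.
Qed.

(** Conjugation by Delta. Cancelling Delta shows in [Phi_word] that the value does not depend on the
    representative. *)
Definition Phi (x : M) : M := word (map phi (repr x)).

Lemma mul_Delta x : x ** D = D ** Phi x.
Proof. by rewrite -word_mul_Delta word_repr. Qed.

Lemma Phi_word u : Phi (word u) = word (map phi u).
Proof. by apply: (cancel_l (z := D)); rewrite -mul_Delta word_mul_Delta. Qed.

Lemma Phi_mul x y : Phi (x ** y) = Phi x ** Phi y.
Proof.
apply: (cancel_l (z := D)).
by rewrite -mul_Delta -bmulA mul_Delta !bmulA mul_Delta.
Qed.

Lemma Phi_one : Phi one = one.
Proof. exact: (Phi_word [::]). Qed.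

Lemma Delta_rotate a b : D = a ** b -> D = b ** Phi a.
Proof. by move=> e; apply: (cancel_l (z := a)); rewrite mul_Delta bmulA -e. Qed.

(** By [Delta_rotate], a factor a at the front of Delta can be moved to its end as [Phi a]; hence
    right divisors of simple elements are left divisors of Delta. *)
Lemma simple_rdiv a b : simple (a ** b) -> simple b.
Proof.
move=> [c]; rewrite -bmulA => /Delta_rotate e.
by rewrite /simple e -bmulA; exact: leL_mulr.
Qed.

Lemma simple_Phi a : simple a -> simple (Phi a).
Proof.
move=> [b /Delta_rotate e]; apply: (@simple_rdiv b); rewrite -e.
exact: leL_refl.
Qed.

Fixpoint sprod (j : nat) (x : M) : Prop :=
  if j is j'.+1 then exists a y, [/\ simple a, sprod j' y & x = a ** y]
  else x = one.

Lemma sprod_word u : sprod (size u) (word u).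
Proof.
elim: u => //= s u IH; exists (gen r s), (word u).
by split=> //; [exact: simple_gen|rewrite word_cons].
Qed.

Lemma sprod_prod_seq s : (forall a, a \in s -> simple a) ->
  sprod (size s) (prod_seq s).
Proof.
elim: s => //= a s IH hs; exists a, (prod_seq s); split=> //.
  by apply: hs; rewrite mem_head.
by apply: IH => b bs; apply: hs; rewrite inE bs orbT.
Qed.

Lemma sprod_Phi j x : sprod j x -> sprod j (Phi x).
Proof.
elim: j x => [|j IH] x /=; first by move=> ->; exact: Phi_one.
move=> [a [y [sa sy ->]]]; exists (Phi a), (Phi y).
by split; [exact: simple_Phi|exact: IH|exact: Phi_mul].
Qed.

(** Generators are removed from the left one at a time. If s z = a w with a simple, let s p = a q be
    the lcm of s and a: it divides Delta, so p is simple; then z = p c and w = q c, and the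
    induction on j applies to c. *)
Lemma sprod_rdiv j x y : sprod j (x ** y) -> sprod j y.
Proof.
elim: j x y => [|j IHj] x y /=.
  move=> /(congr1 len); rewrite len_mul (len_one r_hom) => h.
  by apply: (len_eq0 r_hom); lia.
have [u ->] := word_surj x; elim: u => [|s u IHu]; first by rewrite bmul1m.
rewrite word_cons -bmulA => -[a [w [sa sw e]]]; apply: IHu.
have [p [q [E U]]] := lcm_pair_ex r_hom rC e.
have [c [-> ew]] := U _ _ e; exists p, c; split=> //.
  have [[b eb] [b' eb']] := (simple_gen s, sa).
  have [c' [ec' _]] := U _ _ (etrans (esym eb) eb').
  by apply: (@simple_rdiv (gen r s)); exists c'; rewrite -bmulA -ec'.
by apply: (IHj q); rewrite -ew.
Qed.

Definition Dpow (j : nat) : M := iter j (bmul D) one.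

Lemma DpowD i j : Dpow (i + j) = Dpow i ** Dpow j.
Proof.
elim: i => [|i IH]; first by rewrite bmul1m.
by rewrite addSn /Dpow !iterS -!/(Dpow _) IH bmulA.
Qed.

Lemma DpowSr j : Dpow j.+1 = Dpow j ** D.
Proof. by rewrite -addn1 DpowD /Dpow /= bmulm1. Qed.

Lemma mul_Dpow x j : x ** Dpow j = Dpow j ** iter j Phi x.
Proof.
elim: j => [|j IH]; first by rewrite bmul1m bmulm1.
by rewrite DpowSr bmulA IH -bmulA mul_Delta bmulA.
Qed.

Lemma sprod_Dpow j : sprod j (Dpow j).
Proof.
elim: j => //= j IH; exists D, (Dpow j); split=> //; exact: leL_refl.
Qed.

Lemma Phi_order : exists2 m, 0 < m & forall x, iter m Phi x = x.
Proof.
have [_ injphi _] := rD; have [m m0 hm] := iter_inj_id injphi.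
exists m => // x; have [u ->] := word_surj x.
have -> k : iter k Phi (word u) = word (map (iter k phi) u).
  elim: k => [|k IH]; first by rewrite map_id.
  by rewrite iterS IH Phi_word -map_comp.
by rewrite (eq_map hm) map_id.
Qed.

(* A left divisor x of Delta^j is also, up to a power of the finite-order
   automorphism Phi, a right divisor of it. *)
Lemma sprodP j x : sprod j x <-> leL x (Dpow j).
Proof.
split=> [|[y e]].
  elim: j x => [|j IH] x; first by move=> ->; exact: leL_refl.
  move=> [a [w [sa /IH [z e] ->]]].
  have [b eb] : simple (iter j Phi a).
    by elim: j {IH e} => //= j IH; exact: simple_Phi.
  exists (z ** b); rewrite DpowSr eb !bmulA -mul_Dpow e.
  by rewrite -!bmulA.
have e' : Dpow j = y ** iter j Phi x.
  by apply: (cancel_l (z := x)); rewrite mul_Dpow bmulA -e.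
have := sprod_Dpow j; rewrite e' => /sprod_rdiv h.
have [m m0 hm] := Phi_order.
have -> : x = iter (j * m.-1) Phi (iter j Phi x).
  rewrite -iterD addnC -mulnS prednK //.
  elim: j {e e' h} => // j IH; rewrite mulSn iterD -IH hm //.
by elim: (j * _) => //= k IH; exact: sprod_Phi.
Qed.

Lemma leL_Dpow (x : M) : exists j, leL x (Dpow j).
Proof.
have [u ->] := word_surj x; exists (size u); apply/sprodP; exact: sprod_word.
Qed.

Lemma leL_DpowW i j : i <= j -> leL (Dpow i) (Dpow j).
Proof. by move=> /subnKC <-; rewrite DpowD; exact: leL_mulr. Qed.

Lemma lcm_ex (x y : M) : exists p q, lcm_pair x y p q.
Proof.
have [i xi] := leL_Dpow x; have [j yj] := leL_Dpow y.
have [a ea] := leL_trans xi (leL_DpowW (leq_addr j i)).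
have [b eb] := leL_trans yj (leL_DpowW (leq_addl i j)).
exact: (lcm_pair_ex r_hom rC (etrans (esym ea) eb)).
Qed.

Lemma is_lcm_ex (X : {set A}) : exists d : M, is_lcm X d.
Proof.
suff [d [ub least]] : exists d : M,
    (forall s, s \in enum X -> leL (gen r s) d) /\
    (forall e, (forall s, s \in enum X -> leL (gen r s) e) -> leL d e).
  exists d; split=> [s sX|e he]; first by apply: ub; rewrite mem_enum.
  by apply: least => s; rewrite mem_enum; exact: he.
elim: (enum X) => [|t l [d [ub least]]].
  by exists one; split=> // e _; exists e; rewrite bmul1m.
have [p [q [E U]]] := lcm_ex (gen r t) d.
exists (gen r t ** p); split=> [s|e he].
  rewrite inE => /predU1P[->|/ub sd]; first exact: leL_mulr.
  by rewrite E; apply: leL_trans sd (leL_mulr _ _).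
have [a ea] := he t (mem_head _ _).
have [b eb] : leL d e by apply: least => s sl; apply: he; rewrite inE sl orbT.
have [w [ew _]] := U _ _ (etrans (esym ea) eb).
by exists w; rewrite ea ew bmulA.
Qed.

Lemma DeltaX_leL (X : {set A}) (z : M) :
  leL (DeltaX r X) z <-> forall s, s \in X -> leL (gen r s) z.
Proof.
have [ub least] : is_lcm X (DeltaX r X).
  by apply: (@xgetPex _ _ (is_lcm X)); exact: is_lcm_ex.
by split=> [h s /ub sd|]; [exact: leL_trans h|exact: least].
Qed.

Lemma DeltaX_set0 : DeltaX r finset.set0 = one.
Proof.
by apply: (leL_one r_hom); apply/DeltaX_leL => s; rewrite inE.
Qed.

Lemma DeltaX_neq1 (X : {set A}) : X != finset.set0 -> DeltaX r X <> one.
Proof.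
move=> /set0Pn [s sX] e.
have /DeltaX_leL /(_ s sX) [y ey] : leL (DeltaX r X) one.
  by rewrite e; exact: leL_refl.
exact: (@gen_mul_neq1 _ _ r_hom s y).
Qed.

(** * Normal forms *)

Definition normal (s : seq M) :=
  (forall a, a \in s -> simple a /\ a <> one) /\
  (forall i, i.+1 < size s -> arrow (nth one s i) (nth one s i.+1)).

Lemma normal_tail a s : normal (a :: s) -> normal s.
Proof.
move=> [h1 h2]; split=> [b bs|i hi]; first by apply: h1; rewrite inE bs orbT.
exact: (h2 i.+1).
Qed.

(** The head of a normal form is its greatest simple left divisor. The lcm a p of a and t is simple;
    if p were nontrivial, its first letter g would divide the tail, hence by induction the next
    factor b, while a g is simple, against a -> b. *)
Lemma normal_head a s t : normal (a :: s) -> simple t ->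
  leL t (prod_seq (a :: s)) -> leL t a.
Proof.
elim: s a t => [|b s IH] a t nf st; first by rewrite /= bmulm1.
move=> [y ey]; have [p [q [E U]]] := lcm_ex a t.
have [c [ec _]] := U (prod_seq (b :: s)) y ey.
have [ep|/eqP/not_one_gen [g [p' ep]]] := eqVneq p one.
  by exists q; rewrite -E ep bmulm1.
have ap : simple (a ** p).
  have [[d ed] [d' ed']] := (proj1 (proj1 nf a (mem_head _ _)), st).
  have [w [ew _]] := U _ _ (etrans (esym ed) ed').
  by exists w; rewrite -bmulA -ew.
have gb : leL (gen r g) b.
  apply: IH (normal_tail nf) (simple_gen g) _.
  by rewrite ec ep -bmulA; exact: leL_mulr.
case: (proj2 nf 0 isT g gb) => /=.
by apply: leL_trans ap; rewrite ep bmulA; exact: leL_mulr.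
Qed.

(** If the product is b w with b simple, then b divides the head by [normal_head], so the tail is a
    right divisor of w and [sprod_rdiv] applies. *)
Lemma normal_min s j : normal s -> sprod j (prod_seq s) -> size s <= j.
Proof.
elim: s j => // a s IH [|j] nf.
  move=> /= e; have [_ []] := proj1 nf a (mem_head _ _).
  by apply: (leL_one r_hom); rewrite -e; exact: leL_mulr.
move=> [b [w [sb sw e]]]; apply: (IH j (normal_tail nf)).
have [c ec] : leL b a by apply: (normal_head nf sb); rewrite e; exact: leL_mulr.
apply: (@sprod_rdiv _ c); rewrite (_ : _ ** _ = w) //.
by apply: (cancel_l (z := b)); rewrite -e /= ec bmulA.
Qed.

(** Greedy choice: the first factor a is a simple left divisor of maximal length. A failure of a ->
    b would give a generator g dividing b with a g simple, a longer such divisor. *)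
Lemma nf_ex (x : M) : x <> one -> exists s, is_nf x s.
Proof.
move En : (len x) => n; elim/ltn_ind: n => n IH in x En * => x1.
pose P m := `[< exists a, [/\ simple a, leL a x & len a = m] >].
have [s [y exy]] := not_one_gen x1.
have P1 : P 1%N.
  apply/asboolP; exists (gen r s); split; [exact: simple_gen| |exact: len_gen].
  by rewrite exy; exact: leL_mulr.
have PM m : P m -> m <= n.
  by move=> /asboolP [a [_ /(leL_len r_hom) + <-]]; rewrite En.
case: (ex_maxnP (ex_intro P 1%N P1) PM) => m /asboolP [a [sa [x' ex] ea]] max.
have m0 : 0 < m by exact: max.
have an1 : a <> one by move=> e; move: ea m0; rewrite e (len_one r_hom) => <-.
have [e|/eqP x'1] := eqVneq x' one.
  exists [:: a]; split=> //; first by rewrite /= ex e.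
  by move=> b; rewrite inE => /eqP ->.
have [|[|b l] [// _ el ml al]] := IH (len x') _ x' erefl x'1.
  by rewrite -En ex len_mul ea; lia.
exists [:: a, b & l]; split=> //; first by rewrite ex el.
  by move=> c; rewrite inE => /predU1P[->|]; [|exact: ml].
case=> [_|i]; last exact: (al i).
move=> g /= [d ed] sag; suff : P m.+1 by move/max; rewrite ltnn.
apply/asboolP; exists (a ** gen r g); split=> //.
  exists (d ** prod_seq l); rewrite ex el /= ed !bmulA //.
by rewrite len_mul ea len_gen addn1.
Qed.

Lemma tau_gt0 (x : M) : 0 < tau x.
Proof.
rewrite /tau; case: eqP => // /nf_ex nf.
by have [+ _ _ _] := xgetPex [::] nf; case: (xget _ _).
Qed.

Lemma tau_le (x : M) j : 0 < j -> (tau x <= j) <-> leL x (Dpow j).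
Proof.
move=> j0; split=> [tj|xj].
  apply: leL_trans (leL_DpowW tj); rewrite /tau; case: eqP => [->|/nf_ex nf].
    by exists (Dpow 1); rewrite bmul1m.
  move: (xget _ _) (xgetPex [::] nf) => l [_ -> hs _]; apply/sprodP.
  by apply: sprod_prod_seq => a /hs [].
rewrite /tau; case: eqP => // /nf_ex nf.
have [_ e h1 h2] := xgetPex [::] nf; apply: normal_min; first by [].
by rewrite -e; apply/sprodP.
Qed.

Lemma tau_mono (x y : M) : leL x y -> tau x <= tau y.
Proof.
move=> xy; apply/(tau_le _ (tau_gt0 y)); apply: leL_trans xy _.
by apply/(tau_le _ (tau_gt0 y)).
Qed.

(** Heights increase along x, x y, x y z, so the outer two agree exactly when all three do. *)
Lemma Mset_mul (x y z : M) : Mset x (y ** z) <-> Mset x y /\ Mset (x ** y) z.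
Proof.
rewrite /Mset /= bmulA.
have := tau_mono (leL_mulr x y); have := tau_mono (leL_mulr (x ** y) z).
by split=> [e|[]]; lia.
Qed.

Lemma Mset_one (x : M) : Mset x one.
Proof. by rewrite /Mset /= bmulm1. Qed.

Lemma Mset_len (x y : M) : Mset x y -> len (x ** y) <= tau x * len D.
Proof.
move=> e; have /(tau_le _ (tau_gt0 x)) /(leL_len r_hom) : tau (x ** y) <= tau x.
  by rewrite e.
suff -> k : len (Dpow k) = k * len D by [].
by elim: k => [|k IH]; [rewrite (len_one r_hom)|rewrite /= len_mul IH mulSn].
Qed.

Lemma finite_len (n : nat) : finite_set [set x : M | len x <= n].
Proof.
pose g (p : {k : 'I_n.+1 & k.-tuple A}) : M := word (tagged p).
apply: (@sub_finite_set _ _ [set g p | p in [set: _]]).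
  move=> x /=; have [u ->] := word_surj x; rewrite len_word -ltnS => hu.
  by exists (Tagged (fun k : 'I_n.+1 => k.-tuple A)
    (in_tuple u : (Ordinal hu).-tuple A)).
by apply: finite_image; exact: finite_finset.
Qed.

Lemma finite_Mset (x : M) : finite_set (Mset x).
Proof.
apply: sub_finite_set (finite_len (tau x * len D)) => y /= /Mset_len.
by rewrite len_mul; lia.
Qed.

End Garside.

(** * Moebius inversion *)

(** The sum is the expansion of the product over i of 1 - [i in L], which has a zero factor as soon
    as [L] is nonempty. *)
Lemma sum_sign_subset (R : comNzRingType) (T : finType) (L : {set T}) :
  (\sum_(X : {set T} | X \subset L) (-1) ^+ #|X| = (L == finset.set0)%:R :> R)%R.
Proof.
transitivity (\prod_i (- (i \in L)%:R + 1) : R)%R.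
  rewrite bigA_distr big_mkcond /=; apply: eq_bigr => X _.
  rewrite -big_mkcond /=; case: ifPn => [XL|/fintype.subsetPn [i iX iL]].
    rewrite -prodr_const; apply: eq_bigr => i iX.
    by rewrite (fintype.subsetP XL).
  by rewrite (bigD1 i) //= (negPf iL) oppr0 mul0r.
have [->|/set0Pn [i iL]] := eqVneq L finset.set0.
  by rewrite big1 // => i _; rewrite inE oppr0 add0r.
by rewrite (bigD1 i) //= iL addNr mul0r.
Qed.

Section Moebius.
Variables (A : finType) (r : seq A -> seq A -> Prop).
Variables (C : A -> A -> seq A) (phi : A -> A).
Hypothesis r_hom : homogeneous r.
Hypothesis rC : complement_for r C.
Hypothesis rD : quasi_central (Delta r) phi.
Variable R : realType.
Local Notation M := (Mon r).
Local Notation one := (bone r).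
Local Notation "x ** y" := (bmul x y) (at level 40, left associativity).
Implicit Types (x y z : M) (f g h : M -> R).
Local Open Scope ring_scope.

Definition moebius f x := \sum_(X : {set A} | `[< Mset x (DeltaX r X) >])
  (-1) ^+ #|X| * f (x ** DeltaX r X).

Definition zeta h x := \sum_(y \in Mset x) h (x ** y).

(** Left multiplication by d is a bijection from M[x d] onto the multiples of d in M[x], injective
    by cancellation. *)
Lemma zeta_shift h x d : Mset x d ->
  zeta h (x ** d) = \sum_(z \in Mset x `&` [set z | leL d z]) h (x ** z).
Proof.
move=> xd; rewrite (reindex_fsbig (bmul d) (Mset (x ** d))).
  by apply: eq_fsbigr => y _; rewrite bmulA.
split.
- move=> y /= xdy; split; last exact: leL_mulr.
  by apply/(Mset_mul r_hom rC rD).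
- by move=> y z _ _; apply: (bmul_injl r_hom rC).
- move=> z /= [xz [y ey]]; exists y => //.
  by move: xz; rewrite ey => /(Mset_mul r_hom rC rD) [].
Qed.

Lemma moebius_zeta h x : moebius (zeta h) x = h x.
Proof.
have finM := finite_Mset r_hom rC rD.
(* Conditions move into the summand so that both ranges are fixed and the sums can be exchanged. *)
transitivity (\sum_(X : {set A}) \sum_(z \in Mset x)
    if X \subset [set s | `[< leL (gen r s) z >]]%SET
    then (-1) ^+ #|X| * h (x ** z) else 0).
  rewrite /moebius big_mkcond /=; apply: eq_bigr => X _.
  have LX z : (X \subset [set s | `[< leL (gen r s) z >]]%SET) =
              `[< leL (DeltaX r X) z >].
    apply/fintype.subsetP/asboolP => [h1|/(DeltaX_leL r_hom rC rD) h1 s /h1 h2].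
      by apply/(DeltaX_leL r_hom rC rD) => s /h1; rewrite inE => /asboolP.
    by rewrite inE; apply/asboolP.
  case: asboolP => [xX|nxX].
    rewrite zeta_shift // mulr_fsumr fsbig_mkcondr; apply: eq_fsbigr => z _.
    by rewrite LX; congr (if _ then _ else _); apply/idP/asboolP; rewrite inE.
  (* As M[x] is closed under left divisors, no element of it is a multiple of a [DeltaX r X] lying
     outside it. *)
  apply/esym/fsbig1 => z xz; rewrite LX; case: asboolP => // -[y ey].
  by case: nxX; move: xz; rewrite ey => /(Mset_mul r_hom rC rD) [].
under eq_bigr do rewrite fsbig_finite //.
rewrite exchange_big /=.
rewrite -fsbig_finite //= (fsbigD1 one) //=; last exact: Mset_one.
rewrite fsbig1 => [|z [xz z1]].
  rewrite addr0 -big_mkcond /= -mulr_suml sum_sign_subset bmulm1.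
  suff -> : [set s | `[< leL (gen r s) one >]]%SET = finset.set0.
    by rewrite eqxx mul1r.
  apply/setP => s; rewrite !inE; apply/negP => /asboolP [y].
  by move=> /esym; exact: gen_mul_neq1.
rewrite -big_mkcond /= -mulr_suml sum_sign_subset.
have [s [y ey]] := not_one_gen z1.
have /negPf -> : [set s | `[< leL (gen r s) z >]]%SET != finset.set0.
  by apply/set0Pn; exists s; rewrite inE; apply/asboolP; exists y.
by rewrite mul0r.
Qed.

(* The transform is unitriangular with respect to the length within each set
   of elements of a given height, where lengths are bounded. *)
Lemma moebius_inj f g : moebius f =1 moebius g -> f =1 g.
Proof.
move=> fg x; pose b y := (tau y * len (Delta r) - len y)%N.
move En : (b x) => n; elim/ltn_ind: n => n IH in x En *.
have /asboolP x0 : Mset x (DeltaX r finset.set0).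
  by rewrite (DeltaX_set0 r_hom rC rD); exact: Mset_one.
have := fg x; rewrite /moebius (bigD1 finset.set0) //= [RHS](bigD1 finset.set0) //=.
rewrite (DeltaX_set0 r_hom rC rD) bmulm1 cards0 expr0 !mul1r.
have -> : \sum_(X : {set A} | `[< Mset x (DeltaX r X) >] && (X != finset.set0))
    (-1) ^+ #|X| * f (x ** DeltaX r X) =
  \sum_(X : {set A} | `[< Mset x (DeltaX r X) >] && (X != finset.set0))
    (-1) ^+ #|X| * g (x ** DeltaX r X).
  apply: eq_bigr => X /andP [/asboolP xX X0]; congr (_ * _).
  apply: (IH (b (x ** DeltaX r X))) => //; rewrite -En /b.
  (* This bound keeps the truncated subtraction in [b] exact, so that [b] strictly decreases. *)
  have := Mset_len r_hom rC rD xX; rewrite xX len_mul //.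
  have : len (DeltaX r X) <> 0%N.
    by move=> /(len_eq0 r_hom); exact: (DeltaX_neq1 r_hom rC rD X0).
  by lia.
exact: addIr.
Qed.

Lemma moebius_inversion f h : h =1 moebius f <-> f =1 zeta h.
Proof.
split=> [hf|fh].
  by apply: moebius_inj => x; rewrite moebius_zeta hf.
by move=> x; rewrite -(moebius_zeta h); have -> : f = zeta h by apply/funext.
Qed.

End Moebius.

(** * Positive braid monoids *)

Section Artin.
Variable n : nat.
Local Notation A := 'I_n.-1.
Local Notation r := (@artin_rel n).
Local Notation M := (Mon r).
Local Notation one := (bone r).
Local Notation "x ** y" := (bmul x y) (at level 40, left associativity).

Definition adjacent (i j : nat) : bool := (i.+1 == j) || (j.+1 == i).

Definition artin_compl (i j : A) : seq A :=
  if i == j then [::] else if adjacent i j then [:: j; i] else [:: j].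

Lemma artin_hom : homogeneous r.
Proof. by move=> u v []. Qed.

(* Complement on three letters 0, 1, 2 whose adjacencies are given by the
   bits a (for 01), b (for 12) and c (for 02). *)
Definition compl3 (a b c : bool) (i j : nat) : seq nat :=
  if i == j then [::] else
  if (match i, j with
      | 0, 1 | 1, 0 => a | 1, 2 | 2, 1 => b | 0, 2 | 2, 0 => c | _, _ => false
      end) then [:: j; i] else [:: j].

(** The excluded pattern, three pairwise adjacent generators, cannot occur among indices on a
    line. *)
Lemma cube_compl3 a b c : ~~ [&& a, b & c] -> cube (compl3 a b c) 20 0 1 2.
Proof. by case: a b c => [] [] []. Qed.

Lemma artin_complement : complement_for r artin_compl.
Proof.
have adjC i j : adjacent i j = adjacent j i by rewrite /adjacent orbC.
split.
- by move=> s; rewrite /artin_compl eqxx.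
- move=> s t; apply/wordP; rewrite /artin_compl eq_sym adjC.
  case: eqP => [->|st]; first exact: cong_refl.
  apply: cong_rel.
  case: ifP => [ts|/negP nts].
    by apply: ar_braid; move: ts; rewrite /adjacent => /orP [] /eqP; [right|left].
  apply: ar_comm; have /eqP : val t <> val s by move=> /val_inj.
  by move: nts; rewrite /adjacent /=; lia.
- move=> u v [i j ij|i j ij]; exists i, j; rewrite /artin_compl.
    rewrite /adjacent -!val_eqE /=.
    by do !(case: ifP; try lia).
  by rewrite /adjacent -!val_eqE /=; do !(case: ifP; try lia).
move=> s m t sm mt st; exists 20.
pose f i := nth s [:: s; m; t] i.
pose c3 := compl3 (adjacent s m) (adjacent m t) (adjacent s t).
apply: (@cube_map _ _ c3 _ f (fun i => i < 3) _ _ 20 0 1 2) => //.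
- by move=> [|[|[|i]]] [|[|[|j]]] // _ _; rewrite /c3 /compl3 /=; case: ifP.
- have [ms tm ts] : [/\ m != s, t != m & t != s] by split; rewrite eq_sym.
  move=> [|[|[|i]]] [|[|[|j]]] // _ _; rewrite /c3 /compl3 /artin_compl /f /= ?eqxx
    ?(negPf sm, negPf mt, negPf st, negPf ms, negPf tm, negPf ts) //;
    by rewrite ?(adjC m s, adjC t m, adjC t s); case: ifP.
- by apply: cube_compl3; move: sm mt st; rewrite /adjacent -!val_eqE /=; lia.
Qed.

Variable i0 : A.
(** Indices are plain natural numbers, sent to [i0] when out of range, so that words are written
    without bound proofs. *)
Let g (i : nat) : A := odflt i0 (insub i).
Let W (l : seq nat) : M := word r (map g l).
Let sg (i : nat) : M := gen r (g i).

Lemma g_val (i : A) : g i = i.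
Proof. by rewrite /g valK. Qed.

Lemma val_g i : i < n.-1 -> val (g i) = i.
Proof. by move=> h; rewrite /g insubT. Qed.

Lemma W_cons i l : W (i :: l) = sg i ** W l.
Proof. exact: word_cons. Qed.

Lemma W_cat k l : W (k ++ l) = W k ** W l.
Proof. by rewrite /W map_cat word_cat. Qed.

Lemma W_nil : W [::] = one. Proof. by []. Qed.

Lemma artin_sg_comm i j : i < n.-1 -> j < n.-1 -> (i.+1 < j) || (j.+1 < i) ->
  sg i ** sg j = sg j ** sg i.
Proof.
move=> hi hj ij; rewrite -(word_cat _ [:: _]) -(word_cat _ [:: _]).
apply/wordP; apply: cong_rel; apply: ar_comm.
by rewrite -!/(val _) !val_g //; apply/orP.
Qed.

Lemma artin_sg_braid i : i.+1 < n.-1 ->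
  sg i ** sg i.+1 ** sg i = sg i.+1 ** sg i ** sg i.+1.
Proof.
move=> hi; rewrite -!(word_cat _ [:: _]) -!(word_cat _ [:: _; _]).
apply/wordP; apply: cong_rel; apply: ar_braid; left.
by rewrite -!/(val _) !val_g //; lia.
Qed.

Lemma artin_lcm_far i j x y : i < n.-1 -> j < n.-1 ->
  (i.+1 < j) || (j.+1 < i) -> sg i ** x = sg j ** y ->
  exists w, x = sg j ** w /\ y = sg i ** w.
Proof.
move=> hi hj ij /(gen_lcm artin_hom artin_complement) [w].
rewrite /artin_compl /adjacent -!val_eqE /= -!/(val _) !val_g //.
by do !(case: ifP; [lia|move=> _]); exists w.
Qed.

Lemma artin_lcm_adj i x y : i.+1 < n.-1 -> sg i ** x = sg i.+1 ** y ->
  exists w, x = sg i.+1 ** sg i ** w.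
Proof.
move=> hi /(gen_lcm artin_hom artin_complement) [w [+ _]].
rewrite /artin_compl /adjacent -!val_eqE /= -!/(val _) !val_g //; last by lia.
case: ifP => [|_]; first by lia.
case: ifP => [_ ->|]; last by lia.
by exists w; rewrite (word_cat _ [:: _]).
Qed.

Definition far (l : seq nat) (j : nat) :=
  all (fun i => (i < n.-1) && ((i.+1 < j) || (j.+1 < i))) l.

Lemma W_comm l j : j < n.-1 -> far l j -> W l ** sg j = sg j ** W l.
Proof.
move=> hj; elim: l => [|i l IH] /=; first by rewrite W_nil bmul1m bmulm1.
move=> /andP [/andP [hi ij] /IH e].
by rewrite W_cons -bmulA e !bmulA (artin_sg_comm hi hj ij).
Qed.

Lemma W_lcm_l l j x y : j < n.-1 -> far l j -> W l ** x = sg j ** y ->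
  exists w, x = sg j ** w /\ y = W l ** w.
Proof.
move=> hj; elim: l y => [|i l IH] y /=.
  by rewrite W_nil bmul1m => _ ->; exists y; rewrite bmul1m.
move=> /andP [/andP [hi ij] hl]; rewrite W_cons -bmulA.
move=> /(artin_lcm_far hi hj ij) [w [/(IH _ hl) [w' [-> ->]] ->]].
by exists w'; rewrite bmulA.
Qed.

Definition desc (i j : nat) : seq nat := rev (iota i (j - i)).

Lemma descS i j : i <= j -> desc i j.+1 = j :: desc i j.
Proof. by move=> ij; rewrite /desc subSn // -addn1 iotaD rev_cat subnKC. Qed.

Lemma desc_rcons i j : i < j -> desc i j = rcons (desc i.+1 j) i.
Proof. by move=> ij; rewrite /desc -[j - i](@subnSK i j) //= rev_cons. Qed.

Lemma desc_nil i : desc i i = [::].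
Proof. by rewrite /desc subnn. Qed.

Lemma mem_desc i j k : (k \in desc i j) = (i <= k < j).
Proof. by rewrite mem_rev mem_iota; lia. Qed.

Lemma far_desc i j k : j <= n.-1 -> (j < k) || (k.+1 < i) -> far (desc i j) k.
Proof. by move=> hj h; apply/allP => l; rewrite mem_desc; lia. Qed.

(** The generator k commutes with the letters above k+1, becomes k+1 through a braid relation with
    the letters k+1 and k, and then commutes with the letters below. *)
Lemma sg_desc k p : k.+1 < p -> p <= n.-1 ->
  sg k ** W (desc 0 p) = W (desc 0 p) ** sg k.+1.
Proof.
elim: p => // p IH kp pn; rewrite descS // W_cons.
have [kp'|pk] := ltnP k.+1 p.
  rewrite -!bmulA -IH //; last by lia.
  by rewrite !bmulA artin_sg_comm //; lia.
have {pk IH} ep : p = k.+1 by lia.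
move: kp pn; rewrite {}ep => kp pn; rewrite descS // W_cons.
rewrite -!bmulA (W_comm _ (far_desc _ _)) //; try lia.
by rewrite !bmulA artin_sg_braid.
Qed.

Lemma desc_shift j p : j < p -> p <= n.-1 ->
  W (desc 0 j) ** W (desc 0 p) = W (desc 0 p) ** W (desc 1 j.+1).
Proof.
move=> jp pn; elim: j jp => [|j IH] jp.
  by rewrite !desc_nil !W_nil bmul1m bmulm1.
rewrite descS // [desc 1 _]descS // !W_cons -bmulA IH; last by lia.
by rewrite !bmulA sg_desc.
Qed.

(* The Garside element of the parabolic submonoid on the first k generators. *)
Fixpoint half_twist (k : nat) : seq nat :=
  if k is k'.+1 then half_twist k' ++ desc 0 k else [::].

Lemma half_twist_lt k i : i \in half_twist k -> i < k.
Proof.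
elim: k => //= k IH; rewrite mem_cat => /orP [/IH|]; first by lia.
by rewrite mem_desc.
Qed.

Lemma far_half_twist k j : k < j -> j < n.-1 -> far (half_twist k) j.
Proof. by move=> kj jn; apply/allP => l /half_twist_lt; lia. Qed.

(** Brings the top generator to the front, where it is visibly a left divisor: [desc_shift]
    exchanges the last two descending words, and the top letter commutes with the smaller half
    twist. *)
Lemma half_twistSS q : q.+2 <= n.-1 -> W (half_twist q.+2) =
  sg q.+1 ** (W (half_twist q) ** W (desc 0 q.+1) ** W (desc 1 q.+2)).
Proof.
move=> qn; rewrite /= !W_cat -!bmulA desc_shift // descS // W_cons.
by rewrite !bmulA W_comm ?far_half_twist.
Qed.

Lemma sg_half_twist i k : i < k -> k <= n.-1 ->
  sg i ** W (half_twist k) = W (half_twist k) ** sg (k.-1 - i).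
Proof.
elim: k => // k IH ik kn; have [{}ik|ki] := ltnP i k.
  rewrite /= W_cat bmulA IH //; last by lia.
  rewrite -!bmulA sg_desc; [|lia|by []].
  by have -> : (k.-1 - i).+1 = k - i by lia.
have -> : i = k by lia.
rewrite /= subnn; case: k {IH ik ki} kn => [|q] qn; first by rewrite !W_cat !bmul1m.
rewrite /= !W_cat !bmulA -(W_comm _ (far_half_twist _ _)) //.
rewrite -!bmulA; congr (_ ** _); rewrite [in RHS]bmulA [in RHS]desc_shift //.
rewrite bmulA -W_cons -descS // -bmulA; congr (_ ** _).
by rewrite [desc 0 _]desc_rcons // -cats1 W_cat.
Qed.

Lemma sg_leL_half_twist i k : i < k -> k <= n.-1 -> leL (sg i) (W (half_twist k)).
Proof.
elim: k => // k IH ik kn; have [{}ik|ki] := ltnP i k.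
  by rewrite /= W_cat; apply: leL_trans (leL_mulr _ _); apply: IH => //; lia.
have -> : i = k by lia.
case: k {IH ik ki} kn => [|q] qn; last by rewrite half_twistSS //; exact: leL_mulr.
exact: leL_refl.
Qed.

Lemma sg_lcm_l l k x z : k < n.-1 -> far l k -> sg k ** x = W l ** z ->
  exists w, x = W l ** w /\ sg k ** w = z.
Proof.
move=> kn fl /esym /(W_lcm_l kn fl) [w [-> ->]]; by exists w.
Qed.

(** Each induction step removes the first letter of the left word: it passes the letters far above
    it and meets its upper neighbour, whose lcm relation extends the descending word on the right by
    one letter. *)
Lemma desc_lcm k p x y : k <= p -> p < n.-1 ->
  W (desc 0 k) ** x = W (desc k p.+1) ** y -> exists w, x = W (desc 0 p.+1) ** w.
Proof.
elim: k y => [|k IH] y kp pn; first by rewrite W_nil bmul1m => ->; exists y.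
rewrite descS // W_cons -bmulA (@desc_rcons k.+1 p.+1 kp) -cats1 W_cat -bmulA.
move=> /sg_lcm_l [||w [e]]; [by lia|by apply: far_desc; lia|].
move=> /artin_lcm_adj [|v ev]; first by lia.
apply: (IH v (ltnW kp) pn); rewrite e ev (@desc_rcons k p.+1); last by lia.
rewrite (@desc_rcons k.+1 p.+1) // -!cats1 !W_cat !bmulA //.
Qed.

(** Write e as the half twist on p generators times x. The next generator p also divides e and
    commutes with the smaller half twist, hence divides the last descending word times x, and
    [desc_lcm] gives the missing factor of x. *)
Lemma half_twist_least e k : k <= n.-1 -> (forall i, i < k -> leL (sg i) e) ->
  leL (W (half_twist k)) e.
Proof.
elim: k => [|p IH] pn he; first by exists e; rewrite bmul1m.
have [|i ip|x ex] := IH; [lia|by apply: he; lia|].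
have [y ey] := he p (ltnSn _).
suff [w ew] : exists w, x = W (desc 0 p.+1) ** w.
  by exists w; rewrite /= W_cat ex ew bmulA.
have {ex ey} : W (half_twist p) ** x = sg p ** y by rewrite -ex.
case: p pn {IH he} => [|q] qn /=.
  by rewrite W_nil bmul1m => ->; exists y.
rewrite W_cat -bmulA => /(W_lcm_l qn (far_half_twist (ltnSn _) qn)) [z [ez _]].
by apply: (@desc_lcm q.+1 q.+1 x z) => //; rewrite ez descS // desc_nil.
Qed.

Lemma artin_half_twist : quasi_central (W (half_twist n.-1)) (@rev_ord n.-1).
Proof.
split.
- split=> [s _|e he]; first by rewrite -(g_val s); exact: sg_leL_half_twist.
  by apply: half_twist_least => // i _; apply: he; rewrite inE.
- exact: rev_ord_inj.
move=> s; have := sg_half_twist (ltn_ord s) (leqnn _).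
rewrite /sg g_val => ->; congr (_ ** gen _ _); apply: val_inj.
by rewrite val_g /=; have := ltn_ord s; lia.
Qed.

End Artin.

(** * Dual braid monoids *)

(* The complement of the chord p in the lcm of p and q. Crossing chords have as
   lcm the dual Garside element of their four endpoints, of length three. *)
Definition dual_compl_nat (p q : nat * nat) : seq (nat * nat) :=
  let: (i, j) := p in let: (k, l) := q in
  if (i == k) && (j == l) then [::]
  else if (i == k) && (j < l) then [:: (j, l)]
  else if (j == l) && (i < k) then [:: (i, k)]
  else if i == l then [:: (k, j)]
  else if (i < k) && (k < j < l) then [:: (i, k); (j, l)]
  else if (k < i) && (i < l < j) then [:: (k, j); (i, l)]
  else [:: q].

Arguments dual_compl_nat : simpl never.

Definition chords6 : seq (nat * nat) :=
  [seq (i, j) | j <- iota 0 6, i <- iota 0 j].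

Lemma cube_chords6 p q t : p \in chords6 -> q \in chords6 -> t \in chords6 ->
  cube dual_compl_nat 30 p q t.
Proof.
have: all (fun p => all (fun q => all (cube dual_compl_nat 30 p q) chords6)
  chords6) chords6 by vm_compute.
by move=> /allP H /H /allP H' /H' /allP H'' /H''.
Qed.

Definition chord (m : nat) (p : nat * nat) := p.1 < p.2 < m.

Lemma mem_chords6 p : chord 6 p -> p \in chords6.
Proof.
case: p => i j /andP [/= ij j6]; apply/allpairsPdep.
by exists j, i; rewrite !mem_iota /= !add0n.
Qed.

Lemma dual_compl_nat_chord m p q : chord m p -> chord m q ->
  all (chord m) (dual_compl_nat p q).
Proof.
case: p q => [i j] [k l]; rewrite /chord /dual_compl_nat /= => hp hq.
by do !case: ifP => //=; lia.
Qed.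

(** The complement is decided by comparing endpoints only, so strictly increasing relabellings
    commute with it. *)
Lemma dual_compl_nat_map m (h : nat -> nat) p q :
  {in [pred i | i < m] &, {mono h : i j / i < j}} -> chord m p -> chord m q ->
  dual_compl_nat (h p.1, h p.2) (h q.1, h q.2) =
  [seq (h c.1, h c.2) | c <- dual_compl_nat p q].
Proof.
move=> hlt; case: p q => [i j] [k l] /andP [/= ij jm] /andP [/= kl lm].
have im : i < m by lia.
have km : k < m by lia.
have heq a b : a < m -> b < m -> (h a == h b) = (a == b).
  by move=> am bm; have := hlt a b am bm; have := hlt b a bm am; lia.
by rewrite /dual_compl_nat !heq ?hlt //; do !case: ifP.
Qed.

Ltac compl_cases :=
  rewrite /dual_compl_nat; do ![case: ifP => ?]; by [|lia].

Arguments ends : simpl never.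

Section Dual.
Variable n : nat.
Local Notation A := (dgen n).
Local Notation r := (@dual_rel n).
Local Notation M := (Mon r).
Local Notation one := (bone r).
Local Notation "x ** y" := (bmul x y) (at level 40, left associativity).
Variable d : A.

Lemma dual_hom : homogeneous r.
Proof. by move=> u v []. Qed.

Lemma ends_inj : injective (@ends n).
Proof.
by move=> [[a b] hab] [[a' b'] hab'] [/val_inj e1 /val_inj e2]; apply: val_inj;
  rewrite /= e1 e2.
Qed.

Lemma ends_chord (a : A) : chord n (ends a).
Proof. by rewrite /chord (valP a) /=. Qed.

(** Inverse of [ends], with the default [d] on pairs that are not chords. *)
Definition chord_gen (p : nat * nat) : A := odflt d [pick a : A | ends a == p].

Lemma ends_chord_gen p : chord n p -> ends (chord_gen p) = p.
Proof.
case: p => i j /andP [/= ij jn]; rewrite /chord_gen; case: pickP => [a /eqP //|].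
have h : (Ordinal (ltn_trans ij jn) < Ordinal jn)%N by [].
by move=> /(_ (exist _ (Ordinal (ltn_trans ij jn), Ordinal jn) h)); rewrite eqxx.
Qed.

Lemma chord_genK a : chord_gen (ends a) = a.
Proof. by apply: ends_inj; rewrite ends_chord_gen // ends_chord. Qed.

Definition dual_compl (s t : A) : seq A :=
  map chord_gen (dual_compl_nat (ends s) (ends t)).

Let W (l : seq (nat * nat)) : M := word r (map chord_gen l).
Let sg (i j : nat) : M := gen r (chord_gen (i, j)).

Lemma dW_cons p l : W (p :: l) = sg p.1 p.2 ** W l.
Proof. by case: p => i j; exact: word_cons. Qed.

Lemma dual_tri1 i j k : i < j < k -> k < n -> sg i j ** sg j k = sg j k ** sg i k.
Proof.
move=> ijk kn; rewrite -!(word_cat _ [:: _]); apply/wordP/cong_rel.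
by apply: (dr_tri1 ijk); rewrite ends_chord_gen // /chord /=; lia.
Qed.

Lemma dual_tri2 i j k : i < j < k -> k < n -> sg j k ** sg i k = sg i k ** sg i j.
Proof.
move=> ijk kn; rewrite -!(word_cat _ [:: _]); apply/wordP/cong_rel.
by apply: (dr_tri2 ijk); rewrite ends_chord_gen // /chord /=; lia.
Qed.

Lemma dual_comm i j k l : i < j < n -> k < l < n ->
  [|| j < k, l < i, (i < k) && (l < j) | (k < i) && (j < l)] ->
  sg i j ** sg k l = sg k l ** sg i j.
Proof.
move=> ij kl; rewrite -!(word_cat _ [:: _]) => h; apply/wordP.
have [h'|h'] : ((i < j) && (j < k < l)) || ((i < k) && (k < l < j)) \/
  ((k < l) && (l < i < j)) || ((k < i) && (i < j < l)) by lia.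
  by apply/cong_rel; apply: (dr_comm h'); rewrite ends_chord_gen.
by apply/cong_sym/cong_rel; apply: (dr_comm h'); rewrite ends_chord_gen.
Qed.

Lemma dual_compl_sym p q : chord n p -> chord n q ->
  W (p :: dual_compl_nat p q) = W (q :: dual_compl_nat q p).
Proof.
(* Crossing chords: both words represent the dual Garside element of the four endpoints, by triangle
   relations. *)
have cross i k j l : i < k -> k < j -> j < l < n ->
    W [:: (i, j); (i, k); (j, l)] = W [:: (k, l); (i, l); (k, j)].
  move=> ik kj jl; rewrite !dW_cons /= !bmulm1 !bmulA.
  rewrite -(@dual_tri1 i k l); [|lia|lia].
  rewrite -!bmulA -(@dual_tri2 k j l) -?(@dual_tri1 k j l); [|lia|lia|lia|lia].
  rewrite !bmulA; congr (_ ** _).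
  by rewrite -(@dual_tri2 i k j) -?(@dual_tri1 i k j) //; lia.
suff main a b : chord n a -> chord n b -> a.1 < b.1 \/ a.1 = b.1 /\ a.2 <= b.2 ->
    W (a :: dual_compl_nat a b) = W (b :: dual_compl_nat b a).
  move=> hp hq; case: (ltngtP p.1 q.1) => h1.
  - by apply: main => //; left.
  - by apply/esym/main => //; left.
  case: (leqP p.2 q.2) => h2; first by apply: main => //; right.
  by apply/esym/main => //; right; split=> //; exact: ltnW.
case: a b => [i j] [k l] /andP [/= ij jn] /andP [/= kl ln] h.
have [ik|ki] : i < k \/ i = k by lia.
  have [jk|[kj|jk]] : j < k \/ k < j \/ j = k by lia.
  - have -> : dual_compl_nat (i, j) (k, l) = [:: (k, l)] by compl_cases.
    have -> : dual_compl_nat (k, l) (i, j) = [:: (i, j)] by compl_cases.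
    by rewrite !dW_cons /= !bmulm1 dual_comm //; lia.
  - have [jl|[lj|jl]] : j < l \/ l < j \/ j = l by lia.
    + have -> : dual_compl_nat (i, j) (k, l) = [:: (i, k); (j, l)] by compl_cases.
      have -> : dual_compl_nat (k, l) (i, j) = [:: (i, l); (k, j)] by compl_cases.
      by apply: cross; lia.
    + have -> : dual_compl_nat (i, j) (k, l) = [:: (k, l)] by compl_cases.
      have -> : dual_compl_nat (k, l) (i, j) = [:: (i, j)] by compl_cases.
      by rewrite !dW_cons /= !bmulm1 dual_comm //; lia.
    + have -> : dual_compl_nat (i, j) (k, l) = [:: (i, k)] by compl_cases.
      have -> : dual_compl_nat (k, l) (i, j) = [:: (i, j)] by compl_cases.
      by rewrite !dW_cons /= !bmulm1 -jl dual_tri2 //; lia.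
  - have -> : dual_compl_nat (i, j) (k, l) = [:: (k, l)] by compl_cases.
    have -> : dual_compl_nat (k, l) (i, j) = [:: (i, l)] by compl_cases.
    by rewrite !dW_cons /= !bmulm1 -jk dual_tri1 //; lia.
have [jl|jl] : j < l \/ j = l by lia.
  have -> : dual_compl_nat (i, j) (k, l) = [:: (j, l)] by compl_cases.
  have -> : dual_compl_nat (k, l) (i, j) = [:: (i, j)] by compl_cases.
  by rewrite !dW_cons /= !bmulm1 -ki dual_tri1 ?dual_tri2 //; lia.
by rewrite ki jl.
Qed.

(* The complement commutes with order embeddings of the endpoints, so the cube
   condition reduces to chords on the six points 0, ..., 5. *)
Lemma dual_complement : complement_for r dual_compl.
Proof.
have W_ends (a : A) l : word r (a :: map chord_gen l) = W (ends a :: l).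
  by rewrite /W /= chord_genK.
split.
- by move=> a; rewrite /dual_compl /dual_compl_nat; case: ends => i j; rewrite !eqxx.
- by move=> a b; rewrite !W_ends dual_compl_sym ?ends_chord.
- have CE (a b c : A) : dual_compl_nat (ends a) (ends b) = [:: ends c] ->
    dual_compl a b = [:: c].
    by rewrite /dual_compl => -> /=; rewrite chord_genK.
  move=> u v [a b c i j k ijk ea eb ec|a b c i j k ijk ea eb ec|
              a b i j k l h ea eb].
  + exists a, b; rewrite (CE a b b) 1?(CE b a c) // ea eb ?ec; compl_cases.
  + exists b, c; rewrite (CE b c c) 1?(CE c b a) // ec eb ?ea; compl_cases.
  + have := ends_chord a; have := ends_chord b; rewrite ea eb /chord /= => hb ha.
    exists a, b; rewrite (CE a b b) 1?(CE b a a) // ea eb; compl_cases.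
move=> a b c _ _ _; exists 30.
(* Sorting without repetition makes [nth 0 P] an increasing enumeration of the at most six
   endpoints. *)
pose P := sort leq (undup [:: (ends a).1; (ends a).2; (ends b).1; (ends b).2;
                              (ends c).1; (ends c).2]).
pose h := nth 0 P; pose f p := chord_gen (h p.1, h p.2).
have sP : size P <= 6 by rewrite size_sort (leq_trans (size_undup _)).
have ltP : sorted ltn P.
  by rewrite ltn_sorted_uniq_leq sort_uniq undup_uniq sort_sorted //; exact: leq_total.
have hlt : {in [pred i | i < size P] &, {mono h : i j / i < j}}.
  have homo := sorted_ltn_nth ltn_trans 0 ltP; rewrite -/h in homo.
  move=> i j hi hj; case: (ltngtP i j) => [ij|ji|->]; last exact: ltnn.
    exact: homo.
  by apply/negbTE; rewrite -leqNgt ltnW // homo.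
have memP e : (e \in P) = 
    (e \in [:: (ends a).1; (ends a).2; (ends b).1; (ends b).2;
               (ends c).1; (ends c).2]).
  by rewrite mem_sort mem_undup.
have ltn_P e : e \in P -> e < n.
  have lt2 (x : A) : (ends x).1 < n /\ (ends x).2 < n.
    by have := ends_chord x; rewrite /chord; lia.
  rewrite memP !inE; have := lt2 a; have := lt2 b; have := lt2 c; lia.
have fP p : chord (size P) p -> ends (f p) = (h p.1, h p.2).
  move=> /andP [p12 p2]; apply: ends_chord_gen; apply/andP; split=> /=.
    by rewrite hlt // inE; lia.
  by apply/ltn_P/mem_nth.
have code x : (ends x).1 \in P -> (ends x).2 \in P ->
    exists2 p, chord (size P) p & f p = x.
  move=> x1 x2; exists (index (ends x).1 P, index (ends x).2 P).
    rewrite /chord /= index_mem x2 andbT -hlt ?inE ?index_mem // /h !nth_index //.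
    by have /andP [] := ends_chord x.
  by rewrite /f /h /= !nth_index //; exact: chord_genK.
have [||p hp <-] := code a; [by rewrite memP !inE eqxx ?orbT..|].
have [||q hq <-] := code b; [by rewrite memP !inE eqxx ?orbT..|].
have [||t ht <-] := code c; [by rewrite memP !inE eqxx ?orbT..|].
have chord6 u : chord (size P) u -> u \in chords6.
  by move=> hu; apply: mem_chords6; move: hu; rewrite /chord; lia.
apply: (@cube_map _ _ dual_compl_nat _ f (chord (size P))) => //.
- by move=> u v; exact: dual_compl_nat_chord.
- move=> u v hu hv; rewrite /dual_compl !fP // (dual_compl_nat_map hlt) //.
  by rewrite -map_comp.
by apply: cube_chords6; exact: chord6.
Qed.

(** The dual Garside element of the consecutive points i, ..., j. *)
Definition strand (i j : nat) : M := W [seq (k, k.+1) | k <- iota i (j - i)].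

Lemma strandS i j : i <= j -> strand i j.+1 = strand i j ** sg j j.+1.
Proof.
move=> ij; rewrite /strand subSn // -addn1 iotaD map_cat /W map_cat word_cat.
by rewrite subnKC.
Qed.

Lemma strand_cons i j : i < j -> strand i j = sg i i.+1 ** strand i.+1 j.
Proof. by move=> ij; rewrite /strand -[j - i](@subnSK i j) //= dW_cons. Qed.

Lemma strand_nil i : strand i i = one.
Proof. by rewrite /strand subnn. Qed.

Lemma strand_cat i j k : i <= j -> j <= k -> strand i j ** strand j k = strand i k.
Proof.
move=> ij; elim: k => [|k IH] jk.
  have -> : j = 0 by lia.
  by rewrite strand_nil bmulm1.
have [{}jk|kj] := leqP j k; last first.
  have -> : j = k.+1 by lia.
  by rewrite strand_nil bmulm1.
by rewrite !strandS ?bmulA ?IH //; lia.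
Qed.

Lemma sg_strand_comm a b i j : i <= j < n -> a < b < n -> (j < a) || (b < i) ->
  sg a b ** strand i j = strand i j ** sg a b.
Proof.
move=> + ab; elim: j => [|j IH] ij h.
  have -> : i = 0 by lia.
  by rewrite strand_nil bmulm1 bmul1m.
have [ij'|ji] := leqP i j; last first.
  have -> : i = j.+1 by lia.
  by rewrite strand_nil bmulm1 bmul1m.
rewrite strandS // bmulA IH; [|lia|lia].
by rewrite -!bmulA dual_comm //; lia.
Qed.

Lemma strand_head i j : i <= j -> j.+1 < n -> strand i j.+1 = sg i j.+1 ** strand i j.
Proof.
elim: j => [|j IH] ij jn.
  have -> : i = 0 by lia.
  by rewrite strandS // strand_nil bmulm1 bmul1m.
have [ij'|ji] := leqP i j; last first.
  have -> : i = j.+1 by lia.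
  by rewrite strandS // strand_nil bmulm1 bmul1m.
rewrite strandS // IH //; last by lia.
rewrite -bmulA -sg_strand_comm; [|lia|lia|lia].
by rewrite !bmulA dual_tri1 ?dual_tri2 //; lia.
Qed.

Lemma strand_last i j : i < j -> j < n -> strand i j = strand i.+1 j ** sg i j.
Proof.
elim: j => // j IH ij jn.
have [ij'|ji] := ltnP i j; last first.
  have -> : i = j by lia.
  by rewrite strandS // !strand_nil.
rewrite [LHS]strandS ?(ltnW ij') // IH //; last by lia.
rewrite [strand i.+1 j.+1]strandS // -!bmulA dual_tri1 //; lia.
Qed.

Lemma strand_shift i j : i < j -> j.+1 < n ->
  sg i.+1 j.+1 ** strand i j.+1 = strand i j.+1 ** sg i j.
Proof.
move=> ij jn; rewrite [in RHS]strand_last //; last by lia.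
rewrite (@strand_head i.+1 j) // -!bmulA; congr (_ ** _).
rewrite strandS ?(ltnW ij) // strand_last //; last by lia.
by rewrite -bmulA dual_tri1 ?dual_tri2 //; lia.
Qed.

Definition delta : M := strand 0 n.-1.

(** Rotation of n points on a circle by one step. The point 0 becomes n-1, hence the larger
    endpoint. *)
Definition rotate_chord (p : nat * nat) : nat * nat :=
  if p.1 is i.+1 then (i, p.2.-1) else (p.2.-1, n.-1).

Lemma chord_rotate p : chord n p -> chord n (rotate_chord p).
Proof.
by case: p => [[|i] j]; rewrite /chord /rotate_chord /=; lia.
Qed.

Lemma delta_split i j : i <= j -> j < n ->
  delta = strand 0 i ** strand i j ** strand j n.-1.
Proof. by move=> ij jn; rewrite !strand_cat //; lia. Qed.

(** For a chord not starting at 0, delta is split one point before its left end and at its right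
    end: [strand_shift] rotates it across the middle piece, and the outer pieces commute with it. A
    chord (0, j) is absorbed by [strand_head] and reappears at the right end by [strand_last]. *)
Lemma sg_delta i j : i < j -> j < n ->
  sg i j ** delta = delta ** gen r (chord_gen (rotate_chord (i, j))).
Proof.
case: j => // j; rewrite ltnS => ij jn; rewrite /rotate_chord /=.
case: i ij => [|i] ij.
  have jn1 : j < n.-1 by lia.
  rewrite /delta -[in LHS](@strand_cat 0 j n.-1) ?(ltnW jn1) // bmulA -strand_head //.
  rewrite (strand_last jn1) ?bmulA ?strand_cat //; lia.
rewrite (@delta_split i j.+1) //; last by lia.
rewrite !bmulA sg_strand_comm; [|lia|lia|lia].
rewrite -(bmulA (strand 0 i)) strand_shift // -!bmulA.
by rewrite -sg_strand_comm //; lia.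
Qed.

Definition dual_rotate (a : A) : A := chord_gen (rotate_chord (ends a)).

Lemma dual_rotate_inj : injective dual_rotate.
Proof.
move=> a b /(congr1 (@ends n)); rewrite !ends_chord_gen ?chord_rotate ?ends_chord //.
move=> e; apply: ends_inj; move: e (ends_chord a) (ends_chord b).
case: (ends a) (ends b) => [[|i] j] [[|k] l]; rewrite /rotate_chord /chord /=;
  by move=> [] *; congr pair; lia.
Qed.

Lemma sg_leL_delta i j : i < j -> j < n -> leL (sg i j) delta.
Proof.
case: j => // j; rewrite ltnS => ij jn.
rewrite (@delta_split i j.+1) //; last by lia.
rewrite strand_head //.
case: i ij => [|i] ij.
  by rewrite strand_nil bmul1m -bmulA; exact: leL_mulr.
rewrite strandS // !bmulA -(bmulA (strand 0 i)) dual_tri1; [|lia|lia].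
rewrite bmulA -sg_strand_comm; [|lia|lia|lia].
by rewrite -!bmulA; exact: leL_mulr.
Qed.

(** The complement of each earlier consecutive chord towards (j, j+1) is (j, j+1) itself, even when
    they share the point j, so this chord survives the removal of the whole strand. *)
Lemma strand_lcm i j x y : i <= j -> j.+1 < n -> strand i j ** x = sg j j.+1 ** y ->
  exists w, x = sg j j.+1 ** w.
Proof.
move En : (j - i) => k; elim: k i y En => [|k IH] i y En ij jn.
  have -> : i = j by lia.
  by rewrite strand_nil bmul1m => ->; exists y.
have ij' : i < j by lia.
rewrite strand_cons // -bmulA => /(gen_lcm dual_hom dual_complement) [w [+ _]].
rewrite /dual_compl !ends_chord_gen /chord /=; [|lia|lia].
have -> : dual_compl_nat (i, i.+1) (j, j.+1) = [:: (j, j.+1)] by compl_cases.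
by apply: IH => //; lia.
Qed.

Lemma strand_least e j : j < n -> (forall i, i.+1 < n -> leL (sg i i.+1) e) ->
  leL (strand 0 j) e.
Proof.
move=> + he; elim: j => [|j IH] jn; first by exists e; rewrite strand_nil bmul1m.
have [|x ex] := IH; first by lia.
have [y ey] := he j jn.
have [w ew] := strand_lcm (leq0n j) jn (etrans (esym ex) ey).
by exists w; rewrite strandS // ex ew bmulA.
Qed.

Lemma dual_delta : quasi_central delta dual_rotate.
Proof.
have E (a : A) : gen r a = sg (ends a).1 (ends a).2.
  by rewrite /sg -[(_, _)]/(ends a) chord_genK.
split; last 1 first.
- by move=> a; have /andP [] := ends_chord a; rewrite E; exact: sg_delta.
- split=> [a _|e he].
    by have /andP [] := ends_chord a; rewrite E; exact: sg_leL_delta.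
  have /andP [_ n0] := ends_chord d.
  by apply: strand_least => [|i _]; [lia|apply: he; rewrite inE].
exact: dual_rotate_inj.
Qed.

End Dual.

(** * Both braid monoids and the inversion theorem *)

Lemma braid_garside k n : 2 <= n -> exists C phi,
  [/\ homogeneous (@brel k n), complement_for (@brel k n) C &
      quasi_central (Delta (@brel k n)) phi].
Proof.
(* Two strands provide a generator, the default value in both codings of generators by numbers. *)
move=> n2; have n1 : 0 < n.-1 by lia.
case: k.
  exists (@artin_compl n), (@rev_ord n.-1); split.
  - exact: artin_hom.
  - exact: artin_complement.
  - exact: quasi_central_Delta (@artin_hom n) (artin_half_twist (Ordinal n1)).
pose p : 'I_n * 'I_n := (Ordinal (ltnW n2), Ordinal n2).
pose d : dgen n := exist (fun q : 'I_n * 'I_n => is_true (q.1 < q.2)) p isT.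
exists (dual_compl d), (dual_rotate d); split.
- exact: dual_hom.
- exact: dual_complement.
- exact: quasi_central_Delta (@dual_hom n) (dual_delta d).
Qed.

Local Open Scope ring_scope.

Theorem theorem3p10 (k : kind) (n : nat) (hn : (2 <= n)%N) (R : realType)
    (f h : BM k n -> R) :
  (forall x : BM k n,
      h x = \sum_(X : {set gens k n} | `[< Mset x (DeltaX (@brel k n) X) >])
              (-1) ^+ #|X| * f (bmul x (DeltaX (@brel k n) X)))
  <->
  (forall x : BM k n, f x = \sum_(y \in Mset x) h (bmul x y)).
Proof.
have [C [phi [r_hom rC rD]]] := braid_garside k hn.
exact: (moebius_inversion r_hom rC rD f h).
Qed.
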